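(* Let $G$ be a graph and let $t\geq 3$, $q\geq 1$ be integers. Then $\mathrm{pthin}(G\bullet tK_1)=\mathrm{indpthin}(G)$, and $\mathrm{pthin}((G\bullet tK_1)\vee qK_1)=\mathrm{pthin}((G\bullet tK_1)\vee K_q)=\mathrm{indpthin}(G)+1$.
   Context: Graphs are finite, simple, undirected. $tK_1$ is the edgeless graph on $t$ vertices and $K_q$ the complete graph on $q$ vertices. The lexicographical product $G_1\bullet G_2$ has vertex set $V_1\times V_2$, and $(u_1,u_2)$, $(v_1,v_2)$ are adjacent iff either $u_1=v_1$ and $u_2v_2\in E_2$, or $u_1v_1\in E_1$. The join $H_1\vee H_2$ of graphs with disjoint vertex sets is their disjoint union plus all edges between the two vertex sets. For a graph $G=(V,E)$, an ordering $v_1,\dots,v_n$ of $V$ and a partition of $V$ are strongly consistent if for every $r<s<t$, whenever $v_r,v_s$ are in the same class and $v_tv_r\in E$ then $v_tv_s\in E$, and whenever $v_s,v_t$ are in the same class and $v_tv_r\in E$ then $v_sv_r\in E$. $\mathrm{pthin}(G)$ is the minimum number of classes of a partition of $V$ strongly consistent with some ordering of $V$; $\mathrm{indpthin}(G)$ is the same minimum when each class is additionally required to be an independent set. *)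

(* Defs.v *)
From mathcomp Require Import all_boot.

Set Implicit Arguments.
Unset Strict Implicit.
Unset Printing Implicit Defensive.

Record sgraph := SGraph {
  vertex :> finType;
  edge : rel vertex;
  edge_sym : symmetric edge;
  edge_irr : irreflexive edge
}.

Lemma edgeless_sym n : symmetric (fun _ _ : 'I_n => false).
Proof. by []. Qed.

Lemma edgeless_irr n : irreflexive (fun _ _ : 'I_n => false).
Proof. by []. Qed.

Definition edgeless_graph (n : nat) : sgraph :=
  SGraph (@edgeless_sym n) (@edgeless_irr n).

Lemma complete_sym n : symmetric (fun u v : 'I_n => u != v).
Proof. by move=> u v; rewrite eq_sym. Qed.

Lemma complete_irr n : irreflexive (fun u v : 'I_n => u != v).
Proof. by move=> u; rewrite eqxx. Qed.

Definition complete_graph (n : nat) : sgraph :=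
  SGraph (@complete_sym n) (@complete_irr n).

Definition lex_edge (G1 G2 : sgraph) : rel (G1 * G2)%type :=
  fun u v => (u.1 == v.1) && edge u.2 v.2 || edge u.1 v.1.

Lemma lex_sym G1 G2 : symmetric (@lex_edge G1 G2).
Proof.
by move=> u v; rewrite /lex_edge eq_sym (edge_sym u.2) (edge_sym u.1).
Qed.

Lemma lex_irr G1 G2 : irreflexive (@lex_edge G1 G2).
Proof. by move=> u; rewrite /lex_edge !edge_irr andbF. Qed.

Definition lex_product (G1 G2 : sgraph) : sgraph :=
  SGraph (@lex_sym G1 G2) (@lex_irr G1 G2).

Definition join_edge (H1 H2 : sgraph) : rel (H1 + H2)%type :=
  fun u v => match u, v with
             | inl u1, inl v1 => edge u1 v1
             | inr u2, inr v2 => edge u2 v2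
             | _, _ => true
             end.

Lemma join_sym H1 H2 : symmetric (@join_edge H1 H2).
Proof. by case=> u [] v //=; apply: edge_sym. Qed.

Lemma join_irr H1 H2 : irreflexive (@join_edge H1 H2).
Proof. by case=> u /=; apply: edge_irr. Qed.

Definition graph_join (H1 H2 : sgraph) : sgraph :=
  SGraph (@join_sym H1 H2) (@join_irr H1 H2).

Section Thinness.
Variable G : sgraph.

(* An ordering v_0, ..., v_(n-1) of V(G), with n = #|G|, is an injective
   v : 'I_n -> G (hence a bijection). *)
Definition strongly_consistent (v : {ffun 'I_#|G| -> G})
    (P : {set {set G}}) : bool :=
  [forall r : 'I_#|G|, forall s : 'I_#|G|, forall t : 'I_#|G|, (r < s < t) ==>
     ((pblock P (v r) == pblock P (v s)) && edge (v t) (v r)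
        ==> edge (v t) (v s))
  && ((pblock P (v s) == pblock P (v t)) && edge (v t) (v r)
        ==> edge (v s) (v r))].

Definition independent (C : {set G}) : bool :=
  [forall x in C, forall y in C, ~~ edge x y].

Definition strong_partition (P : {set {set G}}) : bool :=
  partition P [set: G] &&
  [exists v : {ffun 'I_#|G| -> G}, injectiveb v && strongly_consistent v P].

Definition pthin_at (k : nat) : bool :=
  [exists P : {set {set G}}, strong_partition P && (#|P| == k)].

Definition indpthin_at (k : nat) : bool :=
  [exists P : {set {set G}},
     [&& strong_partition P, [forall C in P, independent C] & #|P| == k]].

Lemma indpthin_ex : exists k, indpthin_at k.
Proof.
pose P := [set [set x] | x in [set: G]].
have PP : partition P [set: G].
  have -> : P = preim_partition id [set: G].
    apply/setP=> C; apply/imsetP/imsetP => -[x _ ->]; exists x => //;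
      by apply/setP=> y; rewrite !inE eq_sym.
  exact: preim_partitionP.
have tP : trivIset P by case/and3P: PP.
have bP x : pblock P x = [set x].
  by apply: def_pblock => //; [apply/imsetP; exists x | rewrite inE].
exists #|P|; apply/existsP; exists P; rewrite eqxx andbT; apply/andP; split.
  rewrite /strong_partition PP; apply/existsP.
  exists [ffun i => enum_val i].
  have inj : injective [ffun i : 'I_#|G| => enum_val i].
    by move=> i j; rewrite !ffunE => /enum_val_inj.
  apply/andP; split; first exact/injectiveP.
  apply/forallP=> r; apply/forallP=> s; apply/forallP=> t; apply/implyP.
  case/andP=> rs st; rewrite !bP !(inj_eq set1_inj) !(inj_eq inj).
  by rewrite -!val_eqE /= (ltn_eqF rs) (ltn_eqF st).
apply/forall_inP=> _ /imsetP[x _ ->].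
apply/forall_inP=> y /set1P->; apply/forall_inP=> z /set1P->.
by rewrite edge_irr.
Qed.

Lemma pthin_ex : exists k, pthin_at k.
Proof.
have [k /existsP[P /and3P[sP _ cP]]] := indpthin_ex.
by exists k; apply/existsP; exists P; rewrite sP.
Qed.

Definition pthin : nat := ex_minn pthin_ex.
Definition indpthin : nat := ex_minn indpthin_ex.

End Thinness.

(* Main.v *)
(* Orderings and partitions are traded for injective ranks [f : G -> nat] and
   colourings [c].  An independent strongly consistent colouring of G lifts to
   the product with tK_1 by ordering the copies of each vertex consecutively;
   the vertices joined to it go last, in one new class.  Conversely, a vertex lying between
   two of its twins never shares a class with a common neighbour of the three.
   Hence the middle one of three copies of each vertex of G spans a copy of G
   whose classes are independent and avoid the class of any joined vertex. *)
Require Import Defs.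
From mathcomp Require Import all_boot.
From mathcomp Require Import zify.

Set Implicit Arguments.
Unset Strict Implicit.
Unset Printing Implicit Defensive.

(** * Ranks and colourings in place of orderings and partitions *)

Section RankedColouring.
Variables (G : sgraph) (T : finType).
Implicit Types (f : G -> nat) (c : G -> T).

Definition consistent f c : Prop :=
  forall x y z, f x < f y -> f y < f z -> edge z x ->
    (c x = c y -> edge z y) /\ (c y = c z -> edge y x).

Definition proper c : Prop := forall x y, edge x y -> c x <> c y.

(** The position of [x] is the number of vertices of smaller rank, which is injective and below
    [#|G|]; its inverse is the ordering. *)
Lemma ordering_of_rank f : injective f ->
  exists2 v : {ffun 'I_#|G| -> G}, injective v &
    forall i j : 'I_#|G|, i < j -> f (v i) < f (v j).
Proof.
move=> injf; pose below x := [set y | f y < f x].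
have below_lt x : #|below x| < #|G|.
  rewrite -cardsT; apply: proper_card; rewrite properT.
  by apply/eqP => /setP/(_ x); rewrite !inE ltnn.
pose g x := Ordinal (below_lt x).
have mono x y : f x < f y -> g x < g y.
  move=> xy; apply: proper_card; apply/properP; split.
    by apply/subsetP => z; rewrite !inE => /ltn_trans; apply.
  by exists x; rewrite !inE ?ltnn.
have injg : injective g.
  move=> x y exy; apply: injf; apply/eqP.
  case: ltngtP => // /mono; rewrite exy; lia.
have [|h gK hK] := inj_card_bij injg; first by rewrite card_ord.
exists [ffun i => h i] => [i j|i j]; first by rewrite !ffunE => /(can_inj hK).
rewrite !ffunE -{1}[i]hK -{1}[j]hK => lt_ij.
case: (ltngtP (f (h i)) (f (h j))) => // [/mono|/injf eij]; first by lia.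
by rewrite eij ltnn in lt_ij.
Qed.

(** The classes are the fibres of [c]; an attained colour is determined by its fibre, so there are
    as many classes as colours used. *)
Lemma strong_partition_of_colouring f c : injective f -> consistent f c ->
  exists P : {set {set G}},
    [/\ strong_partition P, #|P| = #|c @: [set: G]|
      & proper c -> [forall C in P, independent C]].
Proof.
move=> injf cons; pose P := preim_partition c [set: G].
have PP : partition P [set: G] := preim_partitionP c _.
have tP : trivIset P by case/and3P: PP.
have bP x : pblock P x = [set y | c x == c y].
  have -> : [set y | c x == c y] = [set y in [set: G] | c x == c y].
    by apply/setP => y; rewrite !inE.
  by apply: (def_pblock tP); [apply/imsetP; exists x | rewrite !inE /=].
have eqP' x y : pblock P x = pblock P y -> c x = c y.
  by rewrite !bP => /setP/(_ y); rewrite !inE eqxx => /eqP.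
exists P; split.
- rewrite /strong_partition PP; apply/existsP.
  have [v injv incr] := ordering_of_rank injf.
  exists v; apply/andP; split; first exact/injectiveP.
  apply/forallP=> r; apply/forallP=> s; apply/forallP=> t; apply/implyP.
  case/andP=> rs st; apply/andP; split; apply/implyP;
    case/andP=> /eqP/eqP' ec etr;
    by have [] := cons _ _ _ (incr _ _ rs) (incr _ _ st) etr; auto.
- have -> : P = (fun a => [set y | a == c y]) @: (c @: [set: G]).
    rewrite -imset_comp; apply: eq_imset => x.
    by apply/setP => y; rewrite !inE.
  apply: card_in_imset => _ _ /imsetP[x _ ->] /imsetP[y _ ->].
  by move=> /setP/(_ y); rewrite !inE eqxx => /eqP.
- move=> prop; apply/forall_inP => _ /imsetP[x _ ->].
  apply/forall_inP => y; rewrite !inE => /eqP xy.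
  apply/forall_inP => z; rewrite !inE => /eqP xz.
  by apply/negP => /prop; rewrite -xy -xz.
Qed.

Lemma pthin_le f c : injective f -> consistent f c ->
  pthin G <= #|c @: [set: G]|.
Proof.
move=> /strong_partition_of_colouring sp /sp[P [sP cP _]].
rewrite /pthin; case: ex_minnP => k _; apply.
by apply/existsP; exists P; rewrite sP cP eqxx.
Qed.

Lemma indpthin_le f c : injective f -> consistent f c -> proper c ->
  indpthin G <= #|c @: [set: G]|.
Proof.
move=> /strong_partition_of_colouring sp /sp[P [sP cP ind]] /ind iP.
rewrite /indpthin; case: ex_minnP => k _; apply.
by apply/existsP; exists P; rewrite sP iP cP eqxx.
Qed.

(** If [w] and [y] shared a class, then with [w] before [y] the triple [w], [y], [z] would force an
    edge between [z] and [y], and with [w] after [y] the triple [x], [y], [w] would force one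
    between [y] and [x]. *)
Lemma between_twins f c w x y z :
  injective f -> consistent f c ->
  f x < f y -> f y < f z -> ~~ edge x y -> ~~ edge z y ->
  edge w x -> edge w y -> edge w z -> c w <> c y.
Proof.
move=> injf cons xy yz nxy nzy wx wy wz cwy.
case: (ltngtP (f w) (f y)) => [wlty|yltw|/injf ewy].
- have ezw : edge z w by rewrite edge_sym.
  by have [/(_ cwy)] := cons _ _ _ wlty yz ezw; rewrite (negPf nzy).
- have [_ /(_ (esym cwy))] := cons _ _ _ xy yltw wx.
  by rewrite edge_sym (negPf nxy).
- by rewrite ewy edge_irr in wy.
Qed.

End RankedColouring.

(** The converse passage: the rank is the position in the ordering, and the colour of a vertex is
    its block. *)
Lemma colouring_of_strong_partition (G : sgraph) (P : {set {set G}}) :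
  strong_partition P ->
  exists f : G -> nat,
    [/\ injective f, consistent f (pblock P)
      & #|pblock P @: [set: G]| = #|P|].
Proof.
case/andP=> PP /existsP[v /andP[/injectiveP injv cons]].
have [|h vK hK] := inj_card_bij injv; first by rewrite card_ord.
exists (fun x => nat_of_ord (h x)); split.
- by move=> x y /val_inj/(can_inj hK).
- move=> x y z xy yz ezx.
  move/forallP/(_ (h x))/forallP/(_ (h y))/forallP/(_ (h z)): cons.
  rewrite xy yz /= !hK ezx !andbT => /andP[/implyP A /implyP B].
  by split => /eqP.
(* Blocks are nonempty, so each is the colour of one of its elements. *)
- case/and3P: PP => /eqP covP tP n0P; congr #|pred_of_set _|.
  apply/setP => C; apply/imsetP/idP => [[x _ ->]|CP].
    by apply: pblock_mem; rewrite covP inE.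
  have /set0Pn[x xC] : C != set0 by apply: contraNneq n0P => <-.
  by exists x => //; rewrite (def_pblock tP CP xC).
Qed.

Lemma pthin_colouring (G : sgraph) :
  exists (f : G -> nat) (c : G -> {set G}),
    [/\ injective f, consistent f c & #|c @: [set: G]| = pthin G].
Proof.
rewrite /pthin; case: ex_minnP => k /existsP[P /andP[sP /eqP <-]] _.
by have [f ?] := colouring_of_strong_partition sP; exists f, (pblock P).
Qed.

Lemma indpthin_colouring (G : sgraph) :
  exists (f : G -> nat) (c : G -> {set G}),
    [/\ injective f, consistent f c, proper c
      & #|c @: [set: G]| = indpthin G].
Proof.
rewrite /indpthin; case: ex_minnP => k /existsP[P /and3P[sP iP /eqP <-]] _.
have [f [injf cons cP]] := colouring_of_strong_partition sP.
exists f, (pblock P); split=> // x y exy cxy.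
case/andP: sP => /and3P[/eqP covP _ _] _.
have xb : x \in pblock P x by rewrite mem_pblock covP inE.
have yb : y \in pblock P x by rewrite cxy mem_pblock covP inE.
have bP : pblock P x \in P by apply: pblock_mem; rewrite covP inE.
move/forall_inP/(_ _ bP)/forall_inP/(_ _ xb)/forall_inP/(_ _ yb): iP.
by rewrite exy.
Qed.

Lemma consistent_induced (G H : sgraph) (T : finType) (e : G -> H)
    (f : H -> nat) (c : H -> T) :
  (forall x y, edge (e x) (e y) = edge x y) ->
  consistent f c -> consistent (f \o e) (c \o e).
Proof.
move=> ee cons x y z xy yz; rewrite -!ee => ezx.
exact: cons xy yz ezx.
Qed.

(** * The product with an edgeless graph: middle copies and lifted colourings *)

Lemma exists_middle t (g : 'I_t -> nat) : 2 < t -> injective g ->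
  exists p : 'I_t * 'I_t * 'I_t, g p.1.1 < g p.1.2 /\ g p.1.2 < g p.2.
Proof.
move=> t3 injg.
have t1 : 0 < t by lia.
have t2 : 1 < t by lia.
(* Three indices suffice; the case analysis below sorts them by [g], so that [p.1.2] is the
   median. *)
pose a := Ordinal t1; pose b := Ordinal t2; pose c := Ordinal t3.
have ab : g a != g b by rewrite (inj_eq injg).
have ac : g a != g c by rewrite (inj_eq injg).
have bc : g b != g c by rewrite (inj_eq injg).
case: (ltngtP (g a) (g b)) => [lab|lab|eab]; last by rewrite eab eqxx in ab.
- case: (ltnP (g b) (g c)) => lbc; first by exists (a, b, c).
  case: (ltnP (g a) (g c)) => lac; first by exists (a, c, b); split=> /=; lia.
  by exists (c, a, b); split=> /=; lia.
- case: (ltnP (g a) (g c)) => lac; first by exists (b, a, c).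
  case: (ltnP (g b) (g c)) => lbc; first by exists (b, c, a); split=> /=; lia.
  by exists (c, b, a); split=> /=; lia.
Qed.

Section LexProduct.
Variables (G : sgraph) (t : nat).
Let L := lex_product G (edgeless_graph t).

Lemma edge_lex_edgeless (p q : L) : edge p q = edge p.1 q.1.
Proof. by rewrite /edge /= /lex_edge andbF. Qed.

Lemma lex_middle (f : L -> nat) : 2 < t -> injective f ->
  exists m : G -> 'I_t * 'I_t * 'I_t,
    forall x, f (x, (m x).1.1) < f (x, (m x).1.2) /\
              f (x, (m x).1.2) < f (x, (m x).2).
Proof.
move=> t3 injf; apply: (fin_all_exists (P := fun x p =>
  f (x, p.1.1) < f (x, p.1.2) /\ f (x, p.1.2) < f (x, p.2))) => x.
by apply: (exists_middle (g := fun i => f (x, i))) t3 _ => i j /injf[].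
Qed.

(** The embedding [e] lets one argument serve both the product itself and its place inside a join.
    The last conclusion is what makes a joined vertex cost an extra class. *)
Lemma middle_colouring (H : sgraph) (T : finType) (e : L -> H)
    (f : H -> nat) (c : H -> T) :
  2 < t -> injective e -> (forall p q, edge (e p) (e q) = edge p q) ->
  injective f -> consistent f c ->
  exists m : G -> H,
    [/\ injective (f \o m), consistent (f \o m) (c \o m), proper (c \o m)
      & forall w, (forall p, edge w (e p)) -> forall x, c w <> c (m x)].
Proof.
move=> t3 inje ee injf cons.
have [s sP] := lex_middle t3 (inj_comp injf inje).
pose m x := e (x, (s x).1.2).
have em x y : edge (m x) (m y) = edge x y by rewrite ee edge_lex_edgeless.
(* The copies of [x] are pairwise nonadjacent, and the chosen one lies between two others. *)
have key w x : (forall i, edge w (e (x, i))) -> c w <> c (m x).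
  move=> wx; have [lt1 lt2] := sP x.
  by apply: between_twins injf cons lt1 lt2 _ _ (wx _) (wx _) (wx _);
    rewrite ee edge_lex_edgeless /= edge_irr.
exists m; split.
- by move=> x y /injf/inje[].
- exact: consistent_induced.
(* An edge of [G] from [x] to [y] makes [m x] adjacent to every copy of [y]. *)
- by move=> x y exy; apply: key => i; rewrite ee edge_lex_edgeless.
- by move=> w wp x; apply: key.
Qed.

Lemma lex_colouring (T : finType) (f : G -> nat) (c : G -> T) :
  injective f -> consistent f c -> proper c ->
  exists2 f' : L -> nat, injective f'
    & consistent f' (fun p => c p.1).
Proof.
(* Since [p.2 < t], this sorts by [f] first and by copy second. *)
move=> injf cons prop; pose f' (p : L) := f p.1 * t + p.2.
have lt_f' p q : f' p < f' q -> f p.1 <= f q.1.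
  rewrite /f'; have := ltn_ord p.2; have := ltn_ord q.2; nia.
exists f' => [[x i] [y j] exy|p q r /lt_f' pq /lt_f' qr].
  have xy : x = y.
    apply: injf; move: exy; rewrite /f' /=.
    have := ltn_ord i; have := ltn_ord j; nia.
  by move: exy; rewrite /f' xy /= => /addnI/val_inj ->.
rewrite !edge_lex_edgeless => erp.
(* When two consecutive vertices of the triple are copies of one vertex, one requirement is the
   given edge and the premise of the other contradicts properness. *)
move: pq; rewrite leq_eqVlt => /orP[/eqP/injf <-|pq].
  by split=> // /esym /prop-/(_ erp).
move: qr; rewrite leq_eqVlt => /orP[/eqP/injf ->|qr].
  by split=> // /esym /prop-/(_ erp).
exact: cons pq qr erp.
Qed.

Lemma pthin_lex_edgeless : 2 < t -> pthin L = indpthin G.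
Proof.
move=> t3; apply/eqP; rewrite eqn_leq; apply/andP; split.
  have [f [c [injf cons prop <-]]] := indpthin_colouring G.
  have [f' injf' cons'] := lex_colouring injf cons prop.
  apply: leq_trans (pthin_le injf' cons') (subset_leq_card _).
  by apply/subsetP => _ /imsetP[p _ ->]; apply: imset_f.
have [f [c [injf cons <-]]] := pthin_colouring L.
have [//|//|m [injm consm prop _]] :=
  @middle_colouring L _ id f c t3 _ _ injf cons.
apply: leq_trans (indpthin_le injm consm prop) (subset_leq_card _).
by apply/subsetP => _ /imsetP[p _ ->]; apply: imset_f.
Qed.

(** A vertex of [Q] is adjacent to every copy, so its colour misses the middle copies, which already
    use at least [indpthin G] colours. *)
Lemma pthin_join_lex_ge (Q : sgraph) : 2 < t -> 0 < #|Q| ->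
  indpthin G + 1 <= pthin (graph_join L Q).
Proof.
move=> t3 /card_gt0P[w _].
have [f [c [injf cons <-]]] := pthin_colouring (graph_join L Q).
have [||m [injm consm prop avoid]] :=
  @middle_colouring (graph_join L Q) _ inl f c t3 _ _ injf cons => //.
  by move=> p q [].
rewrite addn1 (cardsD1 (c (inr w))) imset_f // add1n ltnS.
apply: leq_trans (indpthin_le injm consm prop) (subset_leq_card _).
apply/subsetP => _ /imsetP[x _ ->]; rewrite in_setD1 /= imset_f // andbT.
by apply/eqP => /esym; apply: avoid.
Qed.

End LexProduct.

(** * Upper bound for joins, and the three equalities *)

(** The bit [b] treats edgeless ([false]) and complete ([true]) graphs at once; all of [Q] takes the
    new colour [None]. *)
Lemma join_colouring (H Q : sgraph) (T : finType) (f : H -> nat) (c : H -> T)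
    (b : bool) :
  (forall x y : Q, edge x y = b && (x != y)) ->
  injective f -> consistent f c ->
  exists2 f' : graph_join H Q -> nat, injective f'
    & consistent f' (fun u => if u is inl p then Some (c p) else None).
Proof.
move=> homQ injf cons; pose N := (\max_x f x).+1.
have ltN x : f x < N by rewrite ltnS; apply: leq_bigmax.
pose f' (u : graph_join H Q) :=
  match u with inl p => f p | inr i => N + enum_rank i end.
exists f'.
  move=> [p|i] [q|j] /=.
  - by move/injf->.
  - by have := ltN p; lia.
  - by have := ltN q; lia.
  - by move/addnI/val_inj/enum_rank_inj->.
(* In mixed triples, either the two colours differ or the required edge crosses the join. *)
move=> [p|i] [q|j] [r|k]; rewrite /f' /= => lt1 lt2 //.
  by move=> erp; have [A B] := cons _ _ _ lt1 lt2 erp; split=> -[].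
(* Inside [Q], one edge forces [b] to be true, so any two distinct vertices are adjacent. *)
rewrite !homQ => /andP[-> _] /=; split=> _; apply/eqP => e.
  by rewrite e ltnn in lt2.
by rewrite e ltnn in lt1.
Qed.

Lemma pthin_join_lex (G Q : sgraph) (t : nat) (b : bool) :
  2 < t -> 0 < #|Q| -> (forall x y : Q, edge x y = b && (x != y)) ->
  pthin (graph_join (lex_product G (edgeless_graph t)) Q) = indpthin G + 1.
Proof.
move=> t3 Q0 homQ; apply/eqP; rewrite eqn_leq pthin_join_lex_ge // andbT.
have [f [c [injf cons prop <-]]] := indpthin_colouring G.
have [f1 injf1 cons1] := lex_colouring t injf cons prop.
have [f2 injf2 cons2] := join_colouring homQ injf1 cons1.
apply: leq_trans (pthin_le injf2 cons2) _.
rewrite addn1 -(card_imset (c @: _) Some_inj) -add1n.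
(* The colours used are those of [G], tagged by [Some], and at most the one extra colour [None]. *)
apply: leq_trans (_ : _ <= #|None |: Some @: (c @: [set: G])|) _.
  apply/subset_leq_card/subsetP => _ /imsetP[[p|i] _ ->]; rewrite !inE //.
  by apply/imset_f/imset_f.
by rewrite cardsU1 leq_add2r leq_b1.
Qed.

Theorem theorem4p21 (G : sgraph) (t q : nat) (ht : 3 <= t) (hq : 1 <= q) :
  pthin (lex_product G (edgeless_graph t)) = indpthin G /\
  pthin (graph_join (lex_product G (edgeless_graph t)) (edgeless_graph q))
    = indpthin G + 1 /\
  pthin (graph_join (lex_product G (edgeless_graph t)) (complete_graph q))
    = indpthin G + 1.
Proof.
split; first exact: pthin_lex_edgeless.
split; first by apply: (@pthin_join_lex _ _ _ false); rewrite ?card_ord.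
by apply: (@pthin_join_lex _ _ _ true); rewrite ?card_ord.
Qed.
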